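(* Let $\lambda=(\lambda_1,\dots,\lambda_l)$ be a partition, $(w_l,\dots,w_1)=(\lambda_1,\dots,\lambda_l)+(l-1,\dots,1,0)$, and $0\le k\le l$. Then $$\partial_1^{N_{\lambda,k}}s_\lambda\Big(\sum_{i=1}^k[x_i]\Big)=c'_{\lambda,k}\,s_{(\lambda_1,\dots,\lambda_k)}\Big(\sum_{i=1}^k[x_i]\Big),\qquad c'_{\lambda,k}=\frac{N_{\lambda,k}!}{\prod_{i=1}^{l-k}w_i!}\prod_{1\le i<j\le l-k}(w_j-w_i).$$
   Context: For $t=(t_1,t_2,\dots)$ define $p_m(t)$ by $\exp(\sum_{m\ge1}t_mk^m)=\sum_{m\ge0}p_m(t)k^m$, $p_m=0$ for $m<0$; $s_\mu(t)=\det(p_{\mu_i-i+j}(t))_{1\le i,j\le l}$ for a partition $\mu=(\mu_1\ge\dots\ge\mu_l)$. $[x]=(x,x^2/2,x^3/3,\dots)$, $\partial_1=\partial/\partial t_1$. $N_{\lambda,k}=\lambda_{k+1}+\dots+\lambda_l$. For $k=0$ the evaluation point is $t=0$ and $s$ of the empty partition is $1$. *)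

(* Defs.v *)
From HB Require Import structures.
From mathcomp Require Import all_boot all_order all_algebra.
From mathcomp Require Import mpoly.
Set Implicit Arguments. Unset Strict Implicit. Unset Printing Implicit Defensive.
Import Order.TTheory GRing.Theory Num.Theory.
Local Open Scope ring_scope.

(* The time variables t = (t_1, t_2, ...) are truncated to t_1..t_{n+1}:
   variable i : 'I_n.+1 of {mpoly rat[n.+1]} stands for t_{i+1}.
   p_m below is exact (involves only t_1..t_m) as long as m <= n+1. *)

Definition tseries (n : nat) : {poly {mpoly rat[n.+1]}} :=
  \sum_(j < n.+1) 'X_j *: 'X^(j.+1).

(* p_m(t) = coefficient of k^m in exp(sum_m t_m k^m); only the terms r <= m
   of the exponential series contribute to the coefficient of k^m. *)
Definition pt (n : nat) (m : nat) : {mpoly rat[n.+1]} :=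
  \sum_(r < m.+1) ((r`!)%:R^-1 : rat) *: ((tseries n) ^+ r)`_m.

Definition ptz (n : nat) (z : int) : {mpoly rat[n.+1]} :=
  match z with Posz m => pt n m | Negz _ => 0 end.

(* s_mu(t) = det (p_{mu_i - i + j})_{1 <= i,j <= l}, l = size mu
   (0-based indices give the same value mu_i - i + j). *)
Definition schur (n : nat) (mu : seq nat) : {mpoly rat[n.+1]} :=
  \det (\matrix_(i < size mu, j < size mu)
          ptz n ((nth 0%N mu i)%:Z - (i : nat)%:Z + (j : nat)%:Z)).

Definition d1 (n : nat) (p : {mpoly rat[n.+1]}) : {mpoly rat[n.+1]} :=
  mderiv ord0 p.

(* evaluation at t = [x_1] + ... + [x_k], i.e. t_m = sum_i x_i^m / m *)
Definition eval_at_x (n k : nat) (p : {mpoly rat[n.+1]}) : {mpoly rat[k]} :=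
  comp_mpoly [tuple ((j.+1)%:R^-1 : rat) *: \sum_(i < k) 'X_i ^+ j.+1 | j < n.+1] p.

Definition is_partition (lam : seq nat) : bool :=
  sorted geq lam && all (fun a => 0 < a)%N lam.

Definition Nlam (lam : seq nat) (k : nat) : nat := sumn (drop k lam).

(* w_i = lam_{l+1-i} + (i - 1), for 1 <= i <= l; here indexed 0-based:
   wlam lam i = w_{i+1} = lam_{l-i} + i. *)
Definition wlam (lam : seq nat) (i : nat) : nat :=
  (nth 0%N lam (size lam - i.+1) + i)%N.

Definition cprime (lam : seq nat) (k : nat) : rat :=
  ((Nlam lam k)`!)%:R / (\prod_(i < size lam - k) ((wlam lam i)`!)%:R)
  * \prod_(i < size lam - k) \prod_(j < size lam - k | (i < j)%N)
      ((wlam lam j)%:R - (wlam lam i)%:R).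

(* Main.v *)
Require Import Defs.
From HB Require Import structures.
From mathcomp Require Import all_boot all_order all_algebra.
From mathcomp Require Import mpoly.
From mathcomp Require Import perm ring zify.
Import Order.TTheory GRing.Theory Num.Theory.
Local Open Scope ring_scope.

(* Shifting t_1 by y turns d_1^N into N! times the coefficient of y^N.  At
   t = [x_1] + ... + [x_k], the p_m shifted in this way have the generating
   function exp(y z) / E(z), E(z) = \prod_i (1 - x_i z).  As E has degree k,
   multiplying the last l - k columns of the Jacobi-Trudi matrix by E is a
   unitriangular column operation, and it replaces their entries by
   y^m / m!.  The determinant is then y^N times one that is block lower
   triangular at y = 0: its first block gives s_(lambda_1, ..., lambda_k), and
   its last block det (1 / (w_i - j)!) is a Vandermonde determinant in
   disguise. *)

(** * Truncated power series and the product E(z) *)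

Lemma mul_geometric_poly (R : comNzRingType) (N : nat) (x : R) :
  (1 - x *: 'X) * \poly_(j < N) x ^+ j.+1 = x%:P - x ^+ N.+1 *: 'X^N.
Proof.
rewrite poly_def; elim: N => [|N IH].
  by rewrite big_ord0 mulr0 expr0 expr1 alg_polyC subrr.
rewrite big_ord_recr /= mulrDr {}IH -!mul_polyC !polyC_exp !exprS; ring.
Qed.

(* The logarithmic derivative of the product is - \sum_x x / (1 - x z), up to
   the truncation order N. *)
Lemma deriv_prod_linear_poly (R : comNzRingType) (N : nat) (xs : seq R) :
  exists W : {poly R},
    (\prod_(x <- xs) (1 - x *: 'X))^`()
    = 'X^N * W - (\prod_(x <- xs) (1 - x *: 'X))
                 * \sum_(x <- xs) \poly_(j < N) x ^+ j.+1.
Proof.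
elim: xs => [|x xs [W IH]].
  by exists 0; rewrite !big_nil derivC !mulr0 subr0.
(* The subtracted term is the truncation error in [mul_geometric_poly] for the new factor. *)
exists ((1 - x *: 'X) * W - x ^+ N.+1 *: \prod_(z <- xs) (1 - z *: 'X)).
rewrite !big_cons derivM {}IH derivB derivC derivZ derivX.
have := mul_geometric_poly R N x.
move: (\poly_(j < N) _) (\prod_(z <- xs) _) (\sum_(z <- xs) _) => g P S.
rewrite -!mul_polyC polyC_exp => gE.
have -> : (1 - x%:P * 'X) * P * (g + S)
   = P * ((1 - x%:P * 'X) * g) + (1 - x%:P * 'X) * P * S by ring.
rewrite gE; ring.
Qed.

(* The hypothesis on q says that its generating function is
   exp(y z) / \prod_x (1 - x z) up to order N. *)
Lemma coef_prod_linear_mul (R : comNzRingType) (N : nat) (xs : seq R) (y : R)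
    (q : nat -> R) :
  q 0%N = 1 ->
  (forall m, (m < N)%N -> q m.+1 *+ m.+1
     = \sum_(j < m.+1) (\sum_(x <- xs) x ^+ j.+1 + y *+ (j == 0%N :> nat))
                       * q (m - j)%N) ->
  forall m, (m <= N)%N ->
    ((\prod_(x <- xs) (1 - x *: 'X)) * \poly_(i < N.+1) q i)`_m *+ m`! = y ^+ m.
Proof.
move=> q0 qS; set E := \prod_(x <- _) _; set P := \poly_(i < _) _.
have [W EW] := deriv_prod_linear_poly R N xs.
pose A := \sum_(x <- xs) \poly_(j < N) x ^+ j.+1.
(* Below order N, E' = -E A and P' = (A + y) P, so the product E P has derivative y E P. *)
have derivQ m : (m < N)%N -> (E * P)`_m.+1 *+ m.+1 = y * (E * P)`_m.
  move=> ltmN.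
  have PS i : (i < N)%N -> (P^`() - (A + y%:P) * P)`_i = 0.
    move=> ltiN; apply/eqP; rewrite coefB subr_eq0 coef_deriv coef_poly ltnS.
    rewrite ltiN qS // coefM; apply/eqP/eq_bigr => j _.
    rewrite coefD coefC coef_poly coef_sum; congr (_ * _); last first.
      by rewrite ifT //; lia.
    congr (_ + _); last by case: eqP.
    by apply: eq_bigr => x _; rewrite coef_poly ifT //; have := ltn_ord j; lia.
  have D : (E * P)^`() = y%:P * (E * P) + 'X^N * (W * P)
             + E * (P^`() - (A + y%:P) * P).
    by rewrite derivM EW -/A -/E; ring.
  rewrite -coef_deriv D !coefD coefCM coefXnM ltmN addr0.
  rewrite [(E * (_ - _))`_m]coefM big1 ?addr0 // => j _.
  by rewrite PS ?mulr0 //; have := ltn_ord j; lia.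
elim=> [_|m IH ltmN].
  rewrite coef0M coef_poly /= q0 mulr1 fact0 mulr1n expr0.
  rewrite /E -horner_coef0 horner_prod big1 // => x _.
  by rewrite !hornerE subr0.
by rewrite factS mulrnA derivQ // -mulrnAr IH ?exprS // ltnW.
Qed.

(** * The exponential series and a recursion for the p_m *)

Lemma coef_exp_lt (R : comNzRingType) (p : {poly R}) (r m : nat) :
  p`_0 = 0 -> (m < r)%N -> (p ^+ r)`_m = 0.
Proof.
move=> p0; elim: r m => // r IH m ltmr; rewrite exprS coefM big_ord_recl p0.
rewrite mul0r add0r big1 // => j _; rewrite IH ?mulr0 //= /bump.
by have := ltn_ord j; lia.
Qed.

(** [pt n m] cuts the exponential series off at a bound depending on m. A common bound gives one
    polynomial to differentiate; its coefficients below N are exact because [tseries n] has no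
    constant term. *)
Definition exp_tseries (n N : nat) : {poly {mpoly rat[n.+1]}} :=
  \sum_(r < N) ((r`!)%:R^-1 : rat)%:MP *: tseries n ^+ r.

Lemma tseries_coef0 (n : nat) : (tseries n)`_0 = 0.
Proof. by rewrite coef_sum big1 // => j _; rewrite coefZ coefXn mulr0. Qed.

Lemma coef_exp_tseries (n N m : nat) :
  (m < N)%N -> (exp_tseries n N)`_m = pt n m.
Proof.
move=> ltmN; rewrite coef_sum /pt [RHS](big_ord_widen _
  (fun r => (r`!)%:R^-1 *: (tseries n ^+ r)`_m) ltmN) [RHS]big_mkcond /=.
apply: eq_bigr => r _; rewrite coefZ mul_mpolyC ltnS.
by case: leqP => // ltmr; rewrite coef_exp_lt ?scaler0 ?tseries_coef0.
Qed.

Lemma deriv_exp_tseries (n N : nat) :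
  (exp_tseries n N.+1)^`() = (tseries n)^`() * exp_tseries n N.
Proof.
rewrite /exp_tseries big_ord_recl expr0 derivD derivZ derivC scaler0 add0r.
rewrite linear_sum /= big_distrr /=; apply: eq_bigr => r _.
rewrite derivZ deriv_exp /= -scalerMnr scalerMnl -scalerAr; congr (_ *: _).
rewrite -rmorphMn /bump add1n; congr _%:MP.
rewrite factS natrM invfM -mulr_natl mulrA mulfV ?mul1r //.
by rewrite pnatr_eq0.
Qed.

(** Coefficient comparison in (exp f)' = f' exp f. *)
Lemma pt_rec (n m : nat) :
  pt n m.+1 *+ m.+1 = \sum_(j < m.+1) (tseries n)^`()`_j * pt n (m - j).
Proof.
rewrite -(coef_exp_tseries n m.+2) // -coef_deriv deriv_exp_tseries coefM.
apply: eq_bigr => j _; rewrite coef_exp_tseries //; lia.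
Qed.

Lemma coef_deriv_tseries (n : nat) (j : 'I_n.+1) :
  (tseries n)^`()`_j = 'X_j *+ j.+1.
Proof.
rewrite coef_deriv coef_sum (bigD1 j) //= coefZ coefXn eqxx mulr1.
rewrite big1 ?addr0 // => i neij; rewrite coefZ coefXn eqSS.
by rewrite eq_sym (inj_eq val_inj) (negPf neij) mulr0.
Qed.

(** * Shifting t_1 by y and evaluating at the x_i *)

Lemma mpoly_alg_ind (n : nat) (R : nzRingType) (P : {mpoly R[n]} -> Prop) :
  (forall c, P c%:MP) -> (forall i, P 'X_i) ->
  (forall p q, P p -> P q -> P (p + q)) ->
  (forall p q, P p -> P q -> P (p * q)) -> forall p, P p.
Proof.
move=> PC PX PD PM; elim/mpolyind => [|c m p _ _ Pp]; first by rewrite -mpolyC0.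
apply: PD => //; rewrite -mul_mpolyC mpolyXE_id; apply: (PM) => //.
have P1 : P 1 by rewrite -mpolyC1.
apply: (big_ind P) => // i _.
by elim: (m i) => [|e IH]; rewrite ?expr0 // exprS; apply: (PM).
Qed.

Lemma rmorph_mpoly_ext (n : nat) (R S : nzRingType)
    (f g : {rmorphism {mpoly R[n]} -> S}) :
  (forall c, f c%:MP = g c%:MP) -> (forall i, f 'X_i = g 'X_i) -> f =1 g.
Proof.
move=> fgC fgX; elim/mpoly_alg_ind => [c|i|p q IHp IHq|p q IHp IHq].
- exact: fgC.
- exact: fgX.
- by rewrite !rmorphD IHp IHq.
- by rewrite !rmorphM IHp IHq.
Qed.

(** Both sides are derivations along f, so comparing them on constants and variables suffices. *)
Lemma deriv_rmorph_mpoly (n : nat) (R : nzRingType) (S : comNzRingType)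
    (f : {rmorphism {mpoly R[n]} -> {poly S}}) (i : 'I_n) :
  (forall c, (f c%:MP)^`() = 0) ->
  (forall j, (f 'X_j)^`() = (j == i)%:R) ->
  forall p, (f p)^`() = f (mderiv i p).
Proof.
move=> fC fX; elim/mpoly_alg_ind => [c|j|p q IHp IHq|p q IHp IHq].
- by rewrite mderivC fC rmorph0.
- rewrite fX mderivX mnm1E; case: eqP => [->|_].
    rewrite -[X in (X - _)%MM]add0m addmK scale1r mpolyX0.
    exact: esym (rmorph1 f).
  by rewrite scale0r (rmorph0 f).
- by rewrite mderivD !rmorphD derivD IHp IHq.
- by rewrite mderivM rmorphD !rmorphM derivM IHp IHq.
Qed.

(* Convertible to eval_at_x, but bundled as a ring morphism. *)
Definition eval_rmorph (n k : nat) :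
    {rmorphism {mpoly rat[n.+1]} -> {mpoly rat[k]}} :=
  comp_mpoly
    [tuple ((j.+1)%:R^-1 : rat) *: \sum_(i < k) 'X_i ^+ j.+1 | j < n.+1].

(* Evaluation at t = (t_1 + y, t_2, ...) with t = [x_1] + ... + [x_k], as a
   polynomial in y. *)
Definition shift_eval (n k : nat) :
    {rmorphism {mpoly rat[n.+1]} -> {poly {mpoly rat[k]}}} :=
  mmap (polyC \o @mpolyC k rat)
    (fun j : 'I_n.+1 => (eval_at_x k 'X_j)%:P + 'X *+ (j == ord0)).

Lemma eval_at_xX (n k : nat) (j : 'I_n.+1) :
  eval_at_x k 'X_j = (j.+1%:R^-1 : rat) *: \sum_(i < k) 'X_i ^+ j.+1.
Proof.
by rewrite /eval_at_x comp_mpolyXU -tnth_nth tnth_mktuple.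
Qed.

Lemma shift_evalC (n k : nat) (c : rat) :
  shift_eval n k c%:MP = (c%:MP)%:P.
Proof. exact: mmapC. Qed.

Lemma shift_evalX (n k : nat) (j : 'I_n.+1) :
  shift_eval n k 'X_j = (eval_at_x k 'X_j)%:P + 'X *+ (j == ord0).
Proof. by rewrite [LHS]mmapX mmap1U. Qed.

Lemma shift_eval0 (n k : nat) (p : {mpoly rat[n.+1]}) :
  (shift_eval n k p)`_0 = eval_at_x k p.
Proof.
pose ev0 : {rmorphism {poly {mpoly rat[k]}} -> {mpoly rat[k]}} := horner_eval 0.
have E : ev0 \o shift_eval n k =1 eval_rmorph n k.
  apply: rmorph_mpoly_ext => [c|j] /=.
    by rewrite shift_evalC /horner_eval hornerC [RHS]comp_mpolyC.
  rewrite shift_evalX /horner_eval hornerD hornerMn hornerC hornerX mul0rn.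
  exact: addr0.
by rewrite -horner_coef0; apply: E.
Qed.

Lemma deriv_shift_eval (n k : nat) (p : {mpoly rat[n.+1]}) :
  (shift_eval n k p)^`() = shift_eval n k (d1 p).
Proof.
apply: deriv_rmorph_mpoly => [c|j]; first by rewrite shift_evalC derivC.
by rewrite shift_evalX derivD derivC add0r derivMn derivX.
Qed.

(** Taylor's formula at y = 0, as differentiating in y amounts to applying [d1] before the shift. *)
Lemma eval_iter_d1 (n k N : nat) (p : {mpoly rat[n.+1]}) :
  eval_at_x k (iter N (@d1 n) p) = (shift_eval n k p)`_N *+ N`!.
Proof.
rewrite -shift_eval0.
have -> : shift_eval n k (iter N (@d1 n) p) = (shift_eval n k p)^`(N).
  by elim: N => [|N IH]; rewrite ?derivn0 // derivnS -IH deriv_shift_eval.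
by rewrite coef_derivn addn0 ffactnn.
Qed.

(** This provides the hypothesis of [coef_prod_linear_mul] over the polynomials in y: (j+1) t_(j+1)
    becomes a power sum, and the shift adds y at j = 0 only. *)
Lemma shift_eval_pt_rec (n k m : nat) : (m < n.+1)%N ->
  shift_eval n k (pt n m.+1) *+ m.+1
  = \sum_(j < m.+1)
      (\sum_(x <- [seq ('X_i : {mpoly rat[k]})%:P | i <- enum 'I_k]) x ^+ j.+1
       + 'X *+ (j == 0%N :> nat)) * shift_eval n k (pt n (m - j)).
Proof.
move=> ltmn; rewrite -rmorphMn pt_rec rmorph_sum; apply: eq_bigr => j _ /=.
have ltjn : (j < n.+1)%N by have := ltn_ord j; lia.
rewrite rmorphM (coef_deriv_tseries n (Ordinal ltjn)); congr (_ * _).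
rewrite rmorphMn /= shift_evalX eval_at_xX mulrnDl; congr (_ + _).
  rewrite -polyCMn -scaler_nat scalerA mulfV ?pnatr_eq0 // scale1r.
  rewrite big_map big_enum rmorph_sum; apply: eq_bigr => i _.
  exact: rmorphXn.
by rewrite -val_eqE /=; case: (j : nat) => [|?]; rewrite ?mulr1n ?mul0rn.
Qed.

Lemma coef_shift_eval_pt (n k m : nat) : (m <= n.+1)%N ->
  ((\prod_(i < k) (1 - ('X_i : {mpoly rat[k]})%:P *: 'X))
    * \poly_(i < n.+2) shift_eval n k (pt n i))`_m
  = ((m`!%:R^-1 : rat)%:MP)%:P * 'X^m.
Proof.
move=> lemn; have := coef_prod_linear_mul _ n.+1
   [seq ('X_i : {mpoly rat[k]})%:P | i <- enum 'I_k] 'X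
   (fun i => shift_eval n k (pt n i)) _ (shift_eval_pt_rec n k) m lemn.
rewrite big_map big_enum /= => <-.
  rewrite mulrnAr -mulrnAl -polyCMn -rmorphMn /= -mulr_natr mulVf ?mul1r //.
  by rewrite pnatr_eq0 -lt0n fact_gt0.
rewrite /pt big_ord_recl big_ord0 addr0 expr0 coef1 /= fact0 invr1 scale1r.
exact: (rmorph1 (shift_eval n k)).
Qed.

(** * Determinant evaluations *)

Lemma horner_ffact_poly (R : comNzRingType) (w j : nat) :
  (\prod_(s < j) ('X - s%:R%:P : {poly R})).[w%:R] = (w ^_ j)%:R.
Proof.
elim: j => [|j IH]; first by rewrite big_ord0 hornerC.
rewrite big_ord_recr hornerM IH !hornerE ffactnSr natrM.
(* For w < j the truncated difference is not the one in R, but the other factor is already 0. *)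
have [lejw|ltwj] := leqP j w; first by rewrite natrB.
by rewrite ffact_small // !mul0r.
Qed.

(* Falling factorials are monic of degree j, so they can replace the powers
   in a Vandermonde determinant. *)
Lemma det_ffact (R : idomainType) (d : nat) (w : 'I_d -> nat) :
  \det (\matrix_(i < d, j < d) (w i ^_ j)%:R : 'M[R]_d)
  = \prod_(i < d) \prod_(j < d | (i < j)%N) ((w j)%:R - (w i)%:R).
Proof.
pose p j : {poly R} := \prod_(s < j) ('X - s%:R%:P).
have size_p j : size (p j) = j.+1.
  rewrite /p -(big_mkord xpredT (fun s => 'X - s%:R%:P)) size_prod_XsubC.
  by rewrite size_iota subn0.
pose C := \matrix_(r < d, j < d) (p j)`_r.
have -> : \matrix_(i, j) (w i ^_ j)%:R
    = (Vandermonde d (\row_i (w i)%:R))^T *m C.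
  apply/matrixP => i j; rewrite !mxE -horner_ffact_poly -/(p j).
  rewrite (horner_coef_wide _ (_ : (size (p j) <= d)%N)) ?size_p //.
  by apply: eq_bigr => r _; rewrite !mxE mulrC.
rewrite det_mulmx det_tr det_Vandermonde -[\det C]det_tr det_trig.
  rewrite [X in _ * X]big1 ?mulr1 => [|j _].
    by apply: eq_bigr => i _; apply: eq_bigr => j _; rewrite !mxE.
  have /monicP : p j \is monic by apply: monic_prod_XsubC.
  by rewrite !mxE lead_coefE size_p.
apply/is_trig_mxP => i j ltij; rewrite !mxE nth_default //.
by rewrite size_p.
Qed.

(** Since 1 / (w - j)! = w^_j / w!, taking 1 / w_i! out of row i leaves falling factorials. The
    conditional guards against truncated subtraction, which would give 1 / 0! for j > w_i. *)
Lemma det_inv_fact (R : numFieldType) (d : nat) (w : 'I_d -> nat) :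
  \det (\matrix_(i < d, j < d)
          (if (j <= w i)%N then ((w i - j)`!)%:R^-1 else 0) : 'M[R]_d)
  = (\prod_(i < d) \prod_(j < d | (i < j)%N) ((w j)%:R - (w i)%:R))
      / \prod_(i < d) ((w i)`!)%:R.
Proof.
rewrite -det_ffact mulrC -prodfV.
rewrite -[X in X * _](_ : \det (diag_mx (\row_i ((w i)`!)%:R^-1)) = _).
  rewrite -det_mulmx mul_diag_mx; congr (\det _); apply/matrixP => i j.
  rewrite !mxE; case: leqP => [lejw|ltwj]; last by rewrite ffact_small ?mulr0.
  rewrite -(ffact_fact lejw) natrM invfM mulrAC mulVf ?mul1r //.
  by rewrite pnatr_eq0 -lt0n ffact_gt0.
by rewrite det_diag; apply: eq_bigr => i _; rewrite mxE.
Qed.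

(* Scaling rows and columns by suitable powers of the variable turns M into a
   matrix that is block lower triangular at 0. *)
Lemma det_lowest_coef (S : idomainType) (k d m N : nat)
    (M : 'M[{poly S}]_(k + d)) (c : 'I_(k + d) -> nat) (s : 'I_d -> nat)
    (a : 'I_(k + d) -> 'I_d -> S) :
  (forall i j, M i (rshift k j) * 'X^(s j) = (a i j)%:P * 'X^(c i)) ->
  (forall i, (m < c (lshift d i))%N) -> (forall i, (c (rshift k i) <= m)%N) ->
  (\sum_(i < d) c (rshift k i) = N + \sum_(j < d) s j)%N ->
  (\det M)`_N
  = \det (\matrix_(i < k, j < k) (M (lshift d i) (lshift d j))`_0)
    * \det (\matrix_(i < d, j < d) a (rshift k i) j).
Proof.
move=> MX ltmc lecm sumc.
(* [B] is [M] with the scaling powers divided out. Its upper right block carries positive exponents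
   [c - m], hence vanishes at 0. *)
pose B : 'M[{poly S}]_(k + d) :=
  block_mx (ulsubmx M)
    (\matrix_(i, j) ((a (lshift d i) j)%:P * 'X^(c (lshift d i) - m)))
    (\matrix_(i, j) ('X^(m - c (rshift k i)) * M (rshift k i) (lshift d j)))
    (\matrix_(i, j) (a (rshift k i) j)%:P).
have scaleB :
   diag_mx (row_mx (const_mx 'X^m) (\row_i 'X^(c (rshift k i)))) *m B
   = M *m diag_mx (row_mx (const_mx 'X^m) (\row_j 'X^(s j))).
  rewrite mul_diag_mx mul_mx_diag; apply/matrixP => i j; rewrite !mxE.
  case: (split_ordP i) => i' ->; case: (split_ordP j) => j' ->;
    rewrite ?row_mxEl ?row_mxEr ?block_mxEul ?block_mxEur ?block_mxEdl
            ?block_mxEdr !mxE.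
  - exact: mulrC.
  - by rewrite MX mulrCA -exprD subnKC // ltnW.
  - by rewrite mulrA -exprD subnKC // mulrC.
  - by rewrite MX mulrC.
have det_scale (p : 'I_d -> nat) :
    \det (diag_mx (row_mx (const_mx 'X^m) (\row_i 'X^(p i))
                   : 'rV[{poly S}]_(k + d)))
    = 'X^(m * k + \sum_(i < d) p i).
  rewrite det_diag big_split_ord /= exprD; congr (_ * _).
    under eq_bigr do rewrite row_mxEl mxE.
    by rewrite prodr_const card_ord exprM.
  under eq_bigr do rewrite row_mxEr mxE.
  by rewrite expr_sum.
(* By [sumc] the two scalings differ by 'X^N, so det M = 'X^N det B and det B is needed only at
   0. *)
move: scaleB => /(congr1 determinant); rewrite !det_mulmx !det_scale sumc.
rewrite addnCA exprD -mulrA mulrCA [RHS]mulrC => /mulfI <-; last first.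
  by rewrite monic_neq0 // monicXn.
rewrite coefXnM ltnn subnn -horner_coef0.
rewrite -[LHS]/(horner_eval 0 (\det B)) -det_map_mx map_block_mx.
rewrite [X in block_mx _ X](_ : _ = 0) ?det_lblock.
  by congr (_ * _); apply: congr1; apply/matrixP => i j;
    rewrite !mxE /= /horner_eval ?horner_coef0 ?coefC.
apply/matrixP => i j.
rewrite !mxE /= /horner_eval hornerM hornerXn expr0n subn_eq0.
by rewrite leqNgt ltmc mulr0.
Qed.

(** * Column operations on the Jacobi-Trudi matrix *)

Lemma schurE (n l : nat) (mu : seq nat) : size mu = l ->
  schur n mu = \det (\matrix_(i < l, j < l)
    ptz n ((nth 0%N mu i)%:Z - (i : nat)%:Z + (j : nat)%:Z)).
Proof. by move=> <-. Qed.

Lemma coef_shift_eval_ptz (n k c s : nat) : (c <= n.+1)%N ->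
  ('X^s * \poly_(i < n.+2) shift_eval n k (pt n i))`_c
  = shift_eval n k (ptz n (c%:Z - s%:Z)).
Proof.
move=> lecn; rewrite coefXnM; case: leqP => [lesc|ltcs].
  by rewrite subzn // coef_poly ifT //; lia.
have -> : c%:Z - s%:Z = Negz (s - c).-1 by lia.
by rewrite (rmorph0 (shift_eval n k)).
Qed.

Lemma size_prod_linear (R : nzRingType) (k : nat) (x : 'I_k -> R) :
  (size (\prod_(i < k) (1 - x i *: 'X))%R <= k.+1)%N.
Proof.
elim: k x => [|k IH] x; first by rewrite big_ord0 size_poly1.
rewrite big_ord_recl; apply: leq_trans (size_polyMleq _ _) _.
have := IH (fun i => x (lift ord0 i)).
have : (size (1 - x ord0 *: 'X)%R <= 2)%N.
  apply: leq_trans (size_polyD _ _) _; rewrite size_poly1 size_polyN geq_max /=.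
  by apply: leq_trans (size_scale_leq _ _) _; rewrite size_polyX.
lia.
Qed.

(* Column operations: shifting the j-th column by the product of the 1 - x_i z
   is a unitriangular combination of the columns, and is allowed for the last
   d columns as that product has degree k. *)
Lemma det_coef_linear_columns (R : comNzRingType) (k d : nat) (x : 'I_k -> R)
    (P : {poly R}) (c : 'I_(k + d) -> nat) :
  \det (\matrix_(i < k + d, j < k + d) ('X^(k + d - j.+1) * P)`_(c i))
  = \det (\matrix_(i < k + d, j < k + d)
      ('X^(k + d - j.+1) *
        ((if (j < k)%N then 1 else \prod_(i < k) (1 - x i *: 'X)) * P))`_(c i)).
Proof.
set E := \prod_(i < k) _; set l := (k + d)%N.
pose f j : {poly R} := 'X^(l - j.+1) * (if (j < k)%N then 1 else E).
have size_E : (size E <= k.+1)%N by apply: size_prod_linear.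
(* For j >= k the degree is at most (l - j - 1) + k <= l - 1, so the l columns present suffice. *)
have size_f j : (j < l)%N -> (size (f j) <= l)%N.
  rewrite /f /l => ltj; apply: leq_trans (size_polyMleq _ _) _.
  rewrite size_polyXn addSn /=; case: ltnP => ljk.
    by rewrite size_poly1; lia.
  by apply: leq_trans (leq_add (leqnn _) size_E) _; lia.
pose U := \matrix_(r < l, j < l) (f j)`_(l - r.+1).
have detU : \det U = 1.
  rewrite -det_tr det_trig.
    rewrite big1 // => j _; rewrite !mxE coefXnM ltnn subnn.
    case: ifP => _; first by rewrite coef1.
    rewrite -horner_coef0 horner_prod big1 // => i _.
    by rewrite !hornerE subr0.
  apply/is_trig_mxP => i j ltij; rewrite !mxE coefXnM ifT //.
  by have := ltn_ord j; lia.
rewrite -[LHS]mulr1 -detU -det_mulmx; congr (\det _); apply/matrixP => i j.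
rewrite !mxE mulrA -/(f j).
have -> : f j * P = \sum_(r < l) (f j)`_r *: ('X^r * P).
  rewrite -[in LHS](coefK (f j)) poly_def (big_ord_widen l
     (fun r => (f j)`_r *: 'X^r)) ?size_f // big_mkcond /= big_distrl /=.
  apply: eq_bigr => r _; case: ltnP => ler; first by rewrite scalerAl.
  by rewrite nth_default // mul0r scale0r.
rewrite coef_sum [RHS](reindex_inj rev_ord_inj) /=; apply: eq_bigr => r _.
by rewrite !mxE coefZ mulrC.
Qed.

(** The w_i number the parts from the last one up, against the order of the rows. *)
Lemma det_rev (R : comNzRingType) (d : nat) (A : 'M[R]_d) :
  \det (\matrix_(i, j) A (rev_ord i) (rev_ord j)) = \det A.
Proof.
pose s := perm (@rev_ord_inj d).
have -> : \matrix_(i, j) A (rev_ord i) (rev_ord j)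
   = row_perm s (col_perm s A).
  by apply/matrixP => i j; rewrite !mxE !permE.
rewrite row_permE col_permE !det_mulmx !det_perm odd_permV mulrCA mulrA.
by rewrite -mulrA -signr_addb addbb mulr1.
Qed.

(** * Assembly of the two blocks and the constant *)

Theorem theorem2p2 (lam : seq nat) (k n : nat) :
  is_partition lam -> (k <= size lam)%N ->
  (head 0%N lam + size lam <= n.+1)%N ->
  eval_at_x k (iter (Nlam lam k) (@d1 n) (schur n lam))
  = cprime lam k *: eval_at_x k (schur n (take k lam)).
Proof.
case/andP=> sorted_lam pos_lam lekl lenl.
have [d size_lam] : {d | size lam = (k + d)%N}.
  by exists (size lam - k)%N; rewrite subnKC.
have nth_lam i j : (i <= j < size lam)%N -> (nth 0 lam j <= nth 0 lam i)%N.
  case/andP=> leij ltjl; apply: (sorted_leq_nth _ _ 0%N sorted_lam) => //.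
  - by move=> a b e /= leba leeb; apply: leq_trans leeb leba.
  - exact: leqnn.
  - by rewrite inE (leq_ltn_trans leij).
(* With i counted from 0, [c i] is w_(l-i). *)
pose c i := (nth 0 lam i + (k + d - i.+1))%N.
have le_c i : (i < k + d)%N -> (c i <= n.+1)%N.
  move=> lti; have := nth_lam 0%N i; rewrite nth0 size_lam lti.
  by move=> /(_ isT); rewrite /c; move: lenl; rewrite size_lam; lia.
have c_gt i : (i < k)%N -> (c k < c i)%N.
  (* For d = 0 the index k is past the end and [c k] is 0 by default; positivity of the parts then
     gives the strict inequality. *)
  move=> ltik; have [d0|d_gt0] := posnP d.
    have := all_nthP 0%N pos_lam i; rewrite size_lam d0 addn0 => /(_ ltik).
    by rewrite /c [nth 0 lam k]nth_default ?size_lam d0 addn0 //; lia.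
  have := nth_lam i k.
  rewrite (ltnW ltik) size_lam -{1}[k]addn0 ltn_add2l d_gt0.
  by move=> /(_ isT); rewrite /c; lia.
have c_le i : (i < d)%N -> (c (k + i) <= c k)%N.
  move=> ltid; have := nth_lam k (k + i)%N.
  rewrite leq_addr size_lam ltn_add2l ltid.
  by move=> /(_ isT); rewrite /c; lia.
have index_c i j : (i < k + d)%N -> (j < k + d)%N ->
    (c i)%:Z - (k + d - j.+1)%:Z = (nth 0%N lam i)%:Z - i%:Z + j%:Z.
  by rewrite /c; lia.
(* The outer variable is z, the inner one y. *)
pose P : {poly {poly {mpoly rat[k]}}} :=
  \poly_(i < n.+2) shift_eval n k (pt n i).
have coefP i j : (i < k + d)%N -> (j < k + d)%N ->
    ('X^(k + d - j.+1) * P)`_(c i)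
    = shift_eval n k (ptz n ((nth 0%N lam i)%:Z - i%:Z + j%:Z)).
  move=> lti ltj; rewrite coef_shift_eval_ptz; last exact: le_c.
  by rewrite index_c.
pose x (i : 'I_k) : {poly {mpoly rat[k]}} := ('X_i)%:P.
(* With s_j = d - j - 1, entry (i, k + j) will become y^(c_i - s_j) / (c_i - s_j)!, or 0 for a
   negative exponent; [a] is its scalar factor. *)
pose a (i : 'I_(k + d)) (j : 'I_d) : {mpoly rat[k]} :=
  (if (d - j.+1 <= c i)%N then ((c i - (d - j.+1))`!)%:R^-1 else 0)%:MP.
rewrite eval_iter_d1 (schurE n _ _ size_lam) -det_map_mx.
rewrite (_ : map_mx _ _ = \matrix_(i < k + d, j < k + d)
                            ('X^(k + d - j.+1) * P)`_(c i)); last first.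
  by apply/matrixP => i j; rewrite !mxE coefP.
rewrite (det_coef_linear_columns _ k d x P (fun i => c i)).
rewrite (det_lowest_coef _ k d (c k) (Nlam lam k) _ (fun i => c i)
           (fun j => d - j.+1)%N a).
(* The indices lambda_i - i + j do not involve l, so the first block at y = 0 is the Jacobi-Trudi
   matrix of the truncated partition. *)
- rewrite [X in X * _](_ : _ = eval_at_x k (schur n (take k lam))); last first.
    rewrite (schurE n k) ?size_takel // -[RHS]/(eval_rmorph n k _) -det_map_mx.
    congr (\det _); apply/matrixP => i j.
    have lti : (i < k + d)%N by rewrite ltn_addr.
    have ltj : (j < k + d)%N by rewrite ltn_addr.
    rewrite !mxE /= ltn_ord mul1r coefP // shift_eval0.
    by rewrite nth_take.
  (* The N! of the constant is the one from Taylor's formula; the last block supplies the rest. *)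
  rewrite [X in _ * X](_ : _ = (cprime lam k / (Nlam lam k)`!%:R)%:MP).
    rewrite mulrC mul_mpolyC -scaler_nat scalerA mulrC divfK //.
    by rewrite pnatr_eq0 -lt0n fact_gt0.
  have -> : cprime lam k / (Nlam lam k)`!%:R =
      \det (\matrix_(i < d, j < d)
        (if (j <= wlam lam i)%N then ((wlam lam i - j)`!)%:R^-1 else 0)
        : 'M[rat]_d).
    rewrite (det_inv_fact _ d (fun i => wlam lam i)) /cprime.
    have -> : (size lam - k)%N = d by rewrite size_lam addKn.
    rewrite [LHS]mulrC -mulrA mulKf; first exact: mulrC.
    by rewrite pnatr_eq0 -lt0n fact_gt0.
  rewrite -det_rev -det_map_mx; congr (\det _); apply/matrixP => i j.
  rewrite !mxE /a /wlam /c size_lam /=.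
  have -> : (k + (d - i.+1))%N = (k + d - i.+1)%N by have := ltn_ord i; lia.
  have -> : (k + d - (k + d - i.+1).+1)%N = i by have := ltn_ord i; lia.
  by have -> : (d - (d - j.+1).+1)%N = j by have := ltn_ord j; lia.
- move=> i j; rewrite mxE /= ltnNge leq_addr /= mulrA.
  have -> : (k + d - (k + j).+1)%N = (d - j.+1)%N by lia.
  rewrite -mulrA coefXnM ltnNge /a; case: leqP => [lesc|ltcs] /=.
    rewrite coef_shift_eval_pt; last by have := le_c i (ltn_ord i); lia.
    by rewrite -mulrA -exprD subnK.
  by rewrite mpolyC0 mul0r polyC0 mul0r.
- by move=> i; exact: (c_gt i (ltn_ord i)).
- by move=> i; exact: (c_le i (ltn_ord i)).
(* In row k + i, [c] is the part plus s_i, so the parts alone make up N. *)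
- rewrite /Nlam sumnE (big_nth 0%N) size_drop size_lam addKn big_mkord.
  rewrite -big_split; apply: eq_bigr => i _; rewrite nth_drop /c /=; lia.
Qed.
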